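(* Let $W$ be a finite complex reflection group with generic Hecke algebra $H$ over $R$, and let $F$ be the splitting field of $H$ described in the context. Assume that $H$ admits a symmetrising trace $\tau : H \to R$. Let $\{b_w : w \in W\}$ be a basis of $H$ as an $R$-module, indexed by the elements of $W$, and let $\{b_w^{\vee} : w \in W\}$ be its dual basis with respect to $\tau$. For any choice of conjugacy class representatives $\{v_C \in C \mid C \in \mathrm{Cl}(W)\}$, the square matrix $(\chi(b_{v_C}))_{\chi, C}$, with $\chi \in \mathrm{Irr}(H\otimes_R F)$ and $C \in \mathrm{Cl}(W)$, is invertible, as it specialises to the character table of $W$; hence there are uniquely determined coefficients $\zeta_{w,C} \in F$ ($w \in W$, $C \in \mathrm{Cl}(W)$) such that $$\chi(b_w) = \sum_{C \in \mathrm{Cl}(W)} \zeta_{w,C}\, \chi(b_{v_C}) \quad \text{for all } \chi \in \mathrm{Irr}(H \otimes_R F).$$ For any such choice of conjugacy class representatives $v_C$, the elements $$y_C = \sum_{w \in W} \zeta_{w,C}\, b_w^{\vee}, \qquad C \in \mathrm{Cl}(W),$$ form a basis of the center $Z(H \otimes_R F)$.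
   Context: A complex reflection group $W$ is a finite subgroup of $\mathrm{GL}_n(\mathbb{C})$ generated by pseudo-reflections (non-trivial elements of $W$ whose fixed points in $\mathbb{C}^n$ form a hyperplane). A pseudo-reflection $s \in W$ of order $e_s$ is distinguished if its only non-trivial eigenvalue is $\exp(-2\pi\sqrt{-1}/e_s)$; $S$ denotes the set of distinguished pseudo-reflections of $W$. Let $B$ be the complex braid group of $W$ (the fundamental group of the quotient by $W$ of the complement in $\mathbb{C}^n$ of the reflecting hyperplanes), with its natural surjection $B \to W$. For each $s \in S$ choose indeterminates $u_{s,1}, \dots, u_{s,e_s}$, with $u_{s,j} = u_{t,j}$ if $s$ and $t$ are conjugate in $W$, and let $R = \mathbb{Z}[u_{s,j}, u_{s,j}^{-1}]$ be the Laurent polynomial ring in them. The generic Hecke algebra $H$ of $W$ is the quotient of the group algebra $R[B]$ by the ideal generated by the elements $(\sigma - u_{s,1})(\sigma - u_{s,2})\cdots(\sigma - u_{s,e_s})$, where $s$ runs over the conjugacy classes of $S$ and $\sigma$ over the braided reflections in $B$ associated to $s$ (generators of the monodromy around the corresponding hyperplane, mapping to $s$ in $W$). It is a known theorem (formerly the BMR freeness conjecture) that $H$ is a free $R$-module of rank $|W|$. Splitting field: there is a positive integer $N_W$ associated to $W$ by Malle such that, with indeterminates $v_{s,j}$ satisfying $v_{s,j}^{N_W} = \exp(-2\pi\sqrt{-1}\,j/e_s)\,u_{s,j}$, and $F = \mathbb{C}(v_{s,j})$, the algebra $H \otimes_R F$ is split semisimple. By Tits' deformation theorem, the specialisation $v_{s,j}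 \mapsto 1$ (i.e. $u_{s,j} \mapsto \exp(2\pi\sqrt{-1}\,j/e_s)$) induces a bijection $\mathrm{Irr}(H\otimes_R F) \to \mathrm{Irr}(W)$ of irreducible characters. $\mathrm{Cl}(W)$ is the set of conjugacy classes of $W$. A symmetrising trace is an $R$-linear map $\tau: H \to R$ with $\tau(h_1h_2) = \tau(h_2h_1)$ for all $h_1,h_2\in H$ such that for some (hence every) $R$-basis $\mathcal{B}$ of $H$ the determinant of $(\tau(bb'))_{b,b'\in\mathcal{B}}$ is a unit of $R$. The dual basis is determined by $\tau(b_{w_1} b_{w_2}^{\vee}) = \delta_{w_1,w_2}$ for all $w_1, w_2\in W$.
   Formalization: The basis is assumed to satisfy that b_w specialises to w under the specialisation of H to C[W]; for a basis merely indexed by W the claim fails (relabelling the T_w of S_3 can make two columns of the matrix equal). *)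

(* Defs.v *)
From HB Require Import structures.
From mathcomp Require Import all_boot all_order all_algebra all_fingroup.
From mathcomp Require Import all_character generic_quotient.
From mathcomp Require Import all_classical all_reals topology normedtype trigo.
From mathcomp Require Import fraction complex finmap.
From mathcomp Require monalg mpoly.
(* Only the canonical structures: the notations of multinomials clash with
   those of mathcomp-analysis. *)
Import (canonicals) monalg mpoly.

Set Implicit Arguments.
Unset Strict Implicit.
Unset Printing Implicit Defensive.

Import Order.TTheory GRing.Theory Num.Theory.
Import numFieldNormedType.Exports.

Local Open Scope classical_set_scope.
Local Open Scope complex_scope.
Local Open Scope ring_scope.
Local Open Scope quotient_scope.

Definition is_basis_of (R : pzRingType) (M : lmodType R) (P : M -> Prop)
    (I : finType) (b : I -> M) : Prop :=
  (forall i, P (b i)) /\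
  forall m, P m -> exists! c : {ffun I -> R}, m = \sum_i c i *: b i.

Definition is_basis (R : pzRingType) (M : lmodType R)
    (I : finType) (b : I -> M) : Prop :=
  is_basis_of (fun _ : M => True) b.

Definition is_central (A : pzRingType) (z : A) : Prop :=
  forall a : A, z * a = a * z.

Inductive two_sided_ideal (A : pzRingType) (G : A -> Prop) : A -> Prop :=
| tsi_gen a : G a -> two_sided_ideal G a
| tsi_0 : two_sided_ideal G 0
| tsi_add a b :
    two_sided_ideal G a -> two_sided_ideal G b -> two_sided_ideal G (a + b)
| tsi_mul a b c : two_sided_ideal G b -> two_sided_ideal G (a * b * c).

Definition is_quotient_by (R : comNzRingType) (A H : algType R)
    (q : {lrmorphism A -> H}) (G : A -> Prop) : Prop :=
  (forall h : H, exists a : A, q a = h) /\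
  (forall a : A, q a = 0 <-> two_sided_ideal G a).

(* [iota : h |-> h (x) 1] exhibits the [F]-algebra [HF] as [H (x)_R F], where
   [F] is an [R]-module through [phi]. *)
Definition is_extension_of_scalars (R : comNzRingType) (F : fieldType)
    (phi : {rmorphism R -> F}) (H : algType R) (HF : algType F)
    (iota : {rmorphism H -> HF}) : Prop :=
  (forall r h, iota (r *: h) = phi r *: iota h) /\
  forall (V : lmodType F) (g : {additive H -> V}),
    (forall r h, g (r *: h) = phi r *: g h) ->
    exists2 f : {linear HF -> V}, forall h, f (iota h) = g h &
      forall f' : {linear HF -> V}, (forall h, f' (iota h) = g h) -> f' =1 f.

Section Representations.
Variables (F : fieldType) (A : algType F).

Definition stable_under (d : nat) (rho : {lrmorphism A -> 'M[F]_d.+1})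
    (U : 'M[F]_d.+1) : Prop :=
  forall a : A, (U *m rho a <= U)%MS.

Definition irreducible_rep (d : nat) (rho : {lrmorphism A -> 'M[F]_d.+1}) : Prop :=
  forall U, stable_under rho U -> U = 0 \/ row_full U.

Definition completely_reducible_rep (d : nat)
    (rho : {lrmorphism A -> 'M[F]_d.+1}) : Prop :=
  forall U, stable_under rho U -> exists V,
    [/\ stable_under rho V, (U :&: V)%MS = 0 & row_full (U + V)%MS].

Definition semisimple_alg : Prop :=
  forall d (rho : {lrmorphism A -> 'M[F]_d.+1}), completely_reducible_rep rho.

Definition split_alg : Prop :=
  forall d (rho : {lrmorphism A -> 'M[F]_d.+1}), irreducible_rep rho ->
  forall M : 'M[F]_d.+1, (forall a, M *m rho a = rho a *m M) -> is_scalar_mx M.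

Definition split_semisimple_alg : Prop := semisimple_alg /\ split_alg.

Definition irreducible_character (chi : A -> F) : Prop :=
  exists d (rho : {lrmorphism A -> 'M[F]_d.+1}),
    irreducible_rep rho /\ forall a, chi a = \tr (rho a).

Definition enumerates_Irr (I : finType) (chi : I -> A -> F) : Prop :=
  [/\ injective chi, forall i, irreducible_character (chi i) &
      forall psi, irreducible_character psi -> exists i, psi = chi i].
End Representations.

Section SymmetrisingTrace.
Variables (R : comNzRingType) (H : algType R).

Definition symmetrising_trace (tau : {scalar H}) : Prop :=
  (forall h1 h2, tau (h1 * h2) = tau (h2 * h1)) /\
  exists m (e : 'I_m -> H), is_basis e /\
    exists u : R, u * \det (\matrix_(i < m, j < m) tau (e i * e j)) = 1.

Definition dual_basis (I : finType) (tau : {scalar H}) (b bd : I -> H) : Prop :=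
  forall i j, tau (b i * bd j) = (i == j)%:R.
End SymmetrisingTrace.

Definition group_algebra (R : comNzRingType) (B : groupType) : Type :=
  monalg.malg B R.

Section GroupAlgebra.
Variables (R : comNzRingType) (B : groupType).
Local Notation RB := (group_algebra R B).
Local Notation U := (@monalg.mkmalgU B R).
Local Notation coef := (@monalg.mcoeff B R).
Local Notation supp := (@monalg.msupp B R).

HB.instance Definition _ :=
  GRing.Lmodule.copy RB (monalg.malg B R).

Definition ga_elt (x : B) : RB := U x 1.

Definition ga_mul (f g : RB) : RB :=
  \sum_(x <- supp f) \sum_(y <- supp g) U (x * y)%g (coef x f * coef y g).

Lemma ga_U0 x : U x 0 = 0 :> RB. Proof. exact: monalg.monalgU0. Qed.
Lemma ga_UD x : {morph U x : c d / c + d}. Proof. exact: monalg.monalgUD. Qed.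

Lemma ga_mulw (d1 d2 : {fset B}) f g :
  fsubset (supp f) d1 -> fsubset (supp g) d2 ->
  ga_mul f g =
    \sum_(x <- d1) \sum_(y <- d2) U (x * y)%g (coef x f * coef y g).
Proof.
move=> le1 le2; rewrite /ga_mul (big_fset_incl _ le1) /=.
  apply/eq_bigr => x _; apply/big_fset_incl => // y _.
  by move/monalg.mcoeff_outdom => ->; rewrite mulr0 ga_U0.
move=> x _ /monalg.mcoeff_outdom fx.
by rewrite big1 // => y _; rewrite fx mul0r ga_U0.
Qed.

Lemma ga_supp_sub f g d : fsubset (supp f `|` supp g)%fset d ->
  [/\ fsubset (supp f) d, fsubset (supp g) d &
      fsubset (supp (f + g : RB)) d].
Proof.
move=> h; split.
- exact: fsubset_trans (fsubsetUl _ _) h.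
- exact: fsubset_trans (fsubsetUr _ _) h.
- exact: fsubset_trans (monalg.msuppD_le _ _) h.
Qed.

Lemma ga_mulDl : left_distributive ga_mul +%R.
Proof.
move=> f1 f2 g.
have [le1 le2 le12] := ga_supp_sub (fsubset_refl (supp f1 `|` supp f2)%fset).
rewrite (ga_mulw le12 (fsubset_refl _)) (ga_mulw le1 (fsubset_refl _)).
rewrite (ga_mulw le2 (fsubset_refl _)) -big_split /=; apply/eq_bigr => x _.
rewrite -big_split /=; apply/eq_bigr => y _.
by rewrite monalg.mcoeffD mulrDl ga_UD.
Qed.

Lemma ga_mulDr : right_distributive ga_mul +%R.
Proof.
move=> g f1 f2.
have [le1 le2 le12] := ga_supp_sub (fsubset_refl (supp f1 `|` supp f2)%fset).
rewrite (ga_mulw (fsubset_refl _) le12) (ga_mulw (fsubset_refl _) le1).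
rewrite (ga_mulw (fsubset_refl _) le2) -big_split /=; apply/eq_bigr => x _.
rewrite -big_split /=; apply/eq_bigr => y _.
by rewrite monalg.mcoeffD mulrDr ga_UD.
Qed.

Lemma ga_mul0l : left_zero 0 ga_mul.
Proof. by move=> g; rewrite /ga_mul monalg.msupp0 big_seq_fset0. Qed.

Lemma ga_mul0r : right_zero 0 ga_mul.
Proof.
by move=> g; rewrite /ga_mul big1 // => x _; rewrite monalg.msupp0 big_seq_fset0.
Qed.

Lemma ga_mulUU x y c d : ga_mul (U x c) (U y d) = U (x * y)%g (c * d).
Proof.
rewrite (ga_mulw monalg.msuppU_le monalg.msuppU_le) !big_seq_fset1.
by rewrite !monalg.mcoeffUU.
Qed.

Lemma ga_E (f : RB) : f = \sum_(x <- supp f) (U x (coef x f) : RB).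
Proof. exact: monalg.monalgE. Qed.

Lemma ga_mul_suml (I : Type) (r : seq I) (f : I -> RB) g :
  ga_mul (\sum_(i <- r) f i) g = \sum_(i <- r) ga_mul (f i) g.
Proof. exact: (big_morph (ga_mul^~ g) (fun _ _ => ga_mulDl _ _ _) (ga_mul0l g)). Qed.

Lemma ga_mul_sumr (I : Type) (r : seq I) (f : I -> RB) g :
  ga_mul g (\sum_(i <- r) f i) = \sum_(i <- r) ga_mul g (f i).
Proof. exact: (big_morph (ga_mul g) (fun _ _ => ga_mulDr _ _ _) (ga_mul0r g)). Qed.

Lemma ga_mulA : associative ga_mul.
Proof.
move=> f g h; rewrite (ga_E f) (ga_E g) (ga_E h).
rewrite !ga_mul_suml; apply: eq_bigr => x _.
rewrite [LHS]ga_mul_sumr (ga_mul_sumr _ _ (U x _)) [RHS]ga_mul_suml.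
apply: eq_bigr => y _; rewrite !ga_mul_sumr; apply: eq_bigr => z _.
by rewrite !ga_mulUU mulrA mulgA.
Qed.

Lemma ga_mul1l : left_id (ga_elt 1%g) ga_mul.
Proof.
move=> f; rewrite (ga_E f) ga_mul_sumr; apply: eq_bigr => x _.
by rewrite ga_mulUU mul1r mul1g.
Qed.

Lemma ga_mul1r : right_id (ga_elt 1%g) ga_mul.
Proof.
move=> f; rewrite (ga_E f) ga_mul_suml; apply: eq_bigr => x _.
by rewrite ga_mulUU mulr1 mulg1.
Qed.

Lemma ga_one_neq0 : ga_elt 1%g != 0.
Proof. by rewrite /ga_elt monalg.monalgU_eq0 oner_eq0. Qed.

HB.instance Definition _ := GRing.Zmodule_isNzRing.Build RB
  ga_mulA ga_mul1l ga_mul1r ga_mulDl ga_mulDr ga_one_neq0.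

Lemma ga_scaleU (a c : R) x : a *: (U x c : RB) = U x (a * c).
Proof.
apply/monalg.malgP => y; rewrite monalg.mcoeffZ !monalg.mcoeffU.
by rewrite mulrnAr.
Qed.

Lemma ga_scaleAl (a : R) (f g : RB) : a *: (f * g) = (a *: f) * g.
Proof.
rewrite -![_ * _]/(ga_mul _ _).
rewrite (ga_E f) (ga_E g).
rewrite ga_mul_suml !scaler_sumr ga_mul_suml; apply: eq_bigr => x _.
rewrite !ga_mul_sumr scaler_sumr; apply: eq_bigr => y _.
by rewrite ga_mulUU !ga_scaleU ga_mulUU mulrA.
Qed.

HB.instance Definition _ := GRing.Lmodule_isLalgebra.Build R RB ga_scaleAl.

Lemma ga_scaleAr (a : R) (f g : RB) : a *: (f * g) = f * (a *: g).
Proof.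
rewrite -![_ * _]/(ga_mul _ _).
rewrite (ga_E f) (ga_E g).
rewrite ga_mul_suml !scaler_sumr ga_mul_suml; apply: eq_bigr => x _.
rewrite !ga_mul_sumr scaler_sumr; apply: eq_bigr => y _.
by rewrite ga_mulUU !ga_scaleU ga_mulUU mulrCA.
Qed.

HB.instance Definition _ := GRing.Lalgebra_isAlgebra.Build R RB ga_scaleAr.
End GroupAlgebra.

Notation ratfun K I := {fraction (mpoly.mpoly #|{: I}| K)}.

Definition ratfun_var (K : idomainType) (I : finType) (i : I) : ratfun K I :=
  tofrac (mpoly.mpolyX K (mpoly.mnm1 (enum_rank i))).

Definition ratfun_cst (K : idomainType) (I : finType) (c : K) : ratfun K I :=
  tofrac (mpoly.mpolyC #|I| c).

Definition is_laurent (I : finType) : pred (ratfun int I) :=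
  fun x => `[< exists (p : mpoly.mpoly #|I| int) (m : mpoly.multinom #|I|),
                 x = tofrac p / tofrac (mpoly.mpolyX int m) >].

Lemma is_laurent_subring (I : finType) : subring_closed (@is_laurent I).
Proof.
have tX0 m : tofrac (mpoly.mpolyX int m) != 0 :> ratfun int I.
  rewrite tofrac_eq0; apply/eqP => /(congr1 (mpoly.mcoeff m)) /eqP.
  by rewrite mpoly.mcoeffX eqxx mpoly.mcoeff0 oner_eq0.
split.
- apply/asboolP; exists 1, mpoly.mnm0.
  by rewrite mpoly.mpolyX0 tofrac1 divr1.
- move=> x y /asboolP[p [m ->]] /asboolP[p' [m' ->]]; apply/asboolP.
  exists (p * mpoly.mpolyX int m' - p' * mpoly.mpolyX int m), (mpoly.mnm_add m m').
  have := addf_div (tofrac p) (- tofrac p') (tX0 m) (tX0 m').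
  by rewrite !mulNr mpoly.mpolyXD tofracB !tofracM => ->.
- move=> x y /asboolP[p [m ->]] /asboolP[p' [m' ->]]; apply/asboolP.
  exists (p * p'), (mpoly.mnm_add m m').
  by rewrite mpoly.mpolyXD !tofracM mulf_div.
Qed.

HB.instance Definition _ (I : finType) :=
  GRing.isSubringClosed.Build (ratfun int I) (@is_laurent I)
    (@is_laurent_subring I).

(* The ring Z[u_i, u_i^-1 | i in I], as a subring of Q(u_i | i in I). *)
Record laurent (I : finType) : predArgType := Laurent {
  laurent_val :> ratfun int I;
  laurent_valP : laurent_val \in @is_laurent I }.

HB.instance Definition _ (I : finType) := [isSub for @laurent_val I].
HB.instance Definition _ (I : finType) := [Choice of laurent I by <:].
HB.instance Definition _ (I : finType) :=
  [SubChoice_isSubComNzRing of laurent I by <:].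

Lemma is_laurent_var (I : finType) (i : I) :
  @ratfun_var int I i \in @is_laurent I.
Proof.
apply/asboolP; exists (mpoly.mpolyX int (mpoly.mnm1 (enum_rank i))), mpoly.mnm0.
by rewrite mpoly.mpolyX0 tofrac1 divr1.
Qed.

Definition laurent_var (I : finType) (i : I) : laurent I :=
  Laurent (is_laurent_var i).

Section Paths.
Variables (R : realType) (T : topologicalType).

(* A path is a function on [R]; only its restriction to [0, 1] matters. *)
Definition is_path (x y : T) (f : R -> T) : Prop :=
  [/\ {within `[0, 1], continuous f}, f 0 = x & f 1 = y].

Definition path_cat (f g : R -> T) : R -> T :=
  fun t => if t <= 2^-1 then f (2 * t) else g (2 * t - 1).

Definition path_rev (f : R -> T) : R -> T := fun t => f (1 - t).

Definition homotopic (x y : T) (f g : R -> T) : Prop :=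
  exists h : R * R -> T,
    [/\ {within `[0, 1] `*` `[0, 1], continuous h},
        forall t, t \in `[0, 1] -> h (0, t) = f t /\ h (1, t) = g t &
        forall s, s \in `[0, 1] -> h (s, 0) = x /\ h (s, 1) = y].

(* [B], with [cl] sending a loop to its class, is the fundamental group of [T]
   at [x0]. In the product of two classes the loop on the left is run first. *)
Definition is_fundamental_group (x0 : T) (B : groupType)
    (cl : (R -> T) -> B) : Prop :=
  [/\ forall b, exists f, is_path x0 x0 f /\ cl f = b,
      forall f g, is_path x0 x0 f -> is_path x0 x0 g ->
        cl f = cl g <-> homotopic x0 x0 f g &
      forall f g, is_path x0 x0 f -> is_path x0 x0 g ->
        cl (path_cat f g) = (cl f * cl g)%g].
End Paths.

Definition cis (R : realType) (t : R) : R[i] := cos t +i* sin t.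

Section ReflectionGroup.
Variables (R : realType) (gT : finGroupType) (n : nat).
(* A finite subgroup of GL_n(C), given as an embedding of the finite group
   [gT]; it acts on column vectors on the left. The space of column vectors
   carries its usual topology through [R[i]^o]. *)
Variable W : mx_representation R[i] [set: gT]%SET n.

Local Notation C := (R[i]).
Local Notation V := ('cV[R[i]^o]_n).

Definition refl_act (w : gT) (v : V) : V := W w *m (v : 'cV[C]_n).

Definition fixed_space (w : gT) : set V := [set v | refl_act w v = v].

Definition is_hyperplane (A : set V) : Prop :=
  exists a : 'rV[C]_n, a != 0 /\ A = [set v : V | a *m (v : 'cV[C]_n) = 0].

Definition pseudo_reflection (w : gT) : Prop :=
  w <> 1%g /\ is_hyperplane (fixed_space w).

Definition complex_reflection_group : Prop :=
  mx_faithful W /\ <<[set w | `[< pseudo_reflection w >]]%SET>>%g = [set: gT]%SET.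

(* Some proper powers of a generator of the stabiliser of a hyperplane are
   also distinguished in this sense (the square, for a cyclic group of order 4
   acting on a line); no braided reflection is associated to them below. *)
Definition distinguished (s : gT) : Prop :=
  pseudo_reflection s /\
  forall a : C, a != 1 ->
    (eigenvalue (W s) a <-> a = cis (- (2 * pi / #[s]%g%:R))).

Definition hyp_complement_set : set V :=
  [set v | forall w, pseudo_reflection w -> ~ fixed_space w v].

Definition hyp_complement : topologicalType := hyp_complement_set.

Definition same_orbit (x y : hyp_complement) : bool :=
  [exists w : gT, refl_act w (set_val x) == set_val y].

Lemma refl_act1 v : refl_act 1%g v = v.
Proof. by rewrite /refl_act repr_mx1 mul1mx. Qed.

Lemma refl_actM w w' v : refl_act w (refl_act w' v) = refl_act (w * w')%g v.
Proof. by rewrite /refl_act mulmxA -repr_mxM ?inE. Qed.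

Lemma same_orbit_refl : reflexive same_orbit.
Proof. by move=> x; apply/existsP; exists 1%g; rewrite refl_act1. Qed.

Lemma same_orbit_sym : symmetric same_orbit.
Proof.
have sym x y : same_orbit x y -> same_orbit y x.
  case/existsP => w /eqP e; apply/existsP; exists w^-1%g.
  by rewrite -e refl_actM mulVg refl_act1.
by move=> x y; apply/idP/idP; apply: sym.
Qed.

Lemma same_orbit_trans : transitive same_orbit.
Proof.
move=> y x z /existsP[w /eqP e] /existsP[w' /eqP e']; apply/existsP.
by exists (w' * w)%g; rewrite -refl_actM e e'.
Qed.

Canonical orbit_equiv : equiv_rel hyp_complement :=
  EquivRel same_orbit same_orbit_refl same_orbit_sym same_orbit_trans.

Definition orbit_space : topologicalType :=
  quotient_topology {eq_quot orbit_equiv}.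

Definition orbit_proj (x : hyp_complement) : orbit_space :=
  \pi_(quotient_topology {eq_quot orbit_equiv}) x.

Section BraidGroup.
Variables (x0 : hyp_complement) (B : groupType) (cl : (R -> orbit_space) -> B).

Definition is_braid_group : Prop := is_fundamental_group (orbit_proj x0) cl.

(* [pr] is the natural surjection from the braid group to [gT]: the class of a
   loop is sent to the [w] such that the lift of the loop starting at [x0] ends
   at [w x0]. *)
Definition natural_surjection (pr : B -> gT) : Prop :=
  forall (f : R -> hyp_complement) (x : hyp_complement) (w : gT),
    is_path x0 x f -> set_val x = refl_act w (set_val x0) ->
    pr (cl (orbit_proj \o f)) = w.

(* The pointwise stabiliser of the hyperplane of [s] has order [e_hyp s]. *)
Definition e_hyp (s : gT) : nat :=
  #|[set w : gT | `[< fixed_space s `<=` fixed_space w >]]%SET|.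

(* A braided reflection associated to [s] is the class of the image of a path
   [p . a . (s p)^-1]: the path [p] runs from [x0] to a point [h + l] close to
   a point [h] of the hyperplane of [s] lying on no other reflecting
   hyperplane, the arc [a] turns around [h] by the angle [-2 pi / e_hyp s], so
   that its image generates the local monodromy, and the arc is required to end
   at [s (h + l)]. The negative orientation is the one matching both the sign
   in [distinguished] and the left-to-right product of loops: passing to
   inverses of loops turns it into the positive orientation and the opposite
   product. *)
Definition braided_reflection (s : gT) (sigma : B) : Prop :=
  exists (p a sp : R -> hyp_complement) (y y' : hyp_complement) (h l : V),
    (fixed_space s h /\
     (forall t, pseudo_reflection t -> fixed_space t h ->
        fixed_space t = fixed_space s) /\
     (forall z : C, 0 < `|z| <= 1 -> hyp_complement_set (h + z *: l))) /\
    (set_val y = h + l /\ set_val y' = refl_act s (set_val y)) /\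
    is_path x0 y p /\
    (is_path y y' a /\
     forall t, t \in `[0, 1] ->
       set_val (a t) = h + cis (- (2 * pi / (e_hyp s)%:R * t)) *: l) /\
    (forall t, t \in `[0, 1] -> set_val (sp t) = refl_act s (set_val (p t))) /\
    sigma = cl (orbit_proj \o path_cat (path_cat p a) (path_rev sp)).
End BraidGroup.

(* The pairs (conjugacy class of [s], [j]) with [s] distinguished and
   [1 <= j <= e_s]: they index the indeterminates. *)
Definition is_param (x : {set gT} * 'I_#|gT|.+1) : bool :=
  [exists s : gT, [&& `[< distinguished s >], x.1 == (s ^: [set: gT])%SET%g,
                      (0 < x.2)%N & (x.2 <= #[s]%g)%N]].

Definition param : finType := {x : {set gT} * 'I_#|gT|.+1 | is_param x}.

Definition par_class (i : param) : {set gT} := (val i).1.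

(* exp (2 pi sqrt(-1) j / e_s), for [i] the pair of the class of [s] and [j] *)
Definition par_root (i : param) : C :=
  cis (2 * pi * (val i).2%:R / #[fingroup.repr (par_class i)]%g%:R).

Definition hecke_ring : comNzRingType := laurent param.

Definition hecke_relator (x0 : hyp_complement) (B : groupType)
    (cl : (R -> orbit_space) -> B) (r : group_algebra hecke_ring B) : Prop :=
  exists s sigma, [/\ distinguished s, braided_reflection x0 cl s sigma &
    r = \prod_(i : param | par_class i == (s ^: [set: gT])%SET%g)
          (ga_elt hecke_ring sigma - (laurent_var i)%:A)].

Definition is_hecke_algebra (x0 : hyp_complement) (B : groupType)
    (cl : (R -> orbit_space) -> B) (H : algType hecke_ring)
    (q : {lrmorphism group_algebra hecke_ring B -> H}) : Prop :=
  is_quotient_by q (hecke_relator x0 cl).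

(* The field C(v_{s,j}), as an extension of [hecke_ring] by
   u_{s,j} = exp (2 pi sqrt(-1) j / e_s) v_{s,j}^N. *)
Definition hecke_field : fieldType := ratfun R[i] param.

Definition is_hecke_embedding (N : nat)
    (phi : {rmorphism hecke_ring -> hecke_field}) : Prop :=
  forall i, phi (laurent_var i) =
    ratfun_cst param (par_root i) * ratfun_var R[i] i ^+ N.

(* The specialisation u_{s,j} |-> exp (2 pi sqrt(-1) j / e_s) of the scalars,
   and the specialisation of the Hecke algebra to the group algebra of [gT]
   induced by the natural surjection. *)
Definition is_scalar_specialisation
    (theta : {rmorphism hecke_ring -> R[i]}) : Prop :=
  forall i, theta (laurent_var i) = par_root i.

Definition is_specialisation (B : groupType) (pr : B -> gT)
    (H : algType hecke_ring)
    (q : {lrmorphism group_algebra hecke_ring B -> H})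
    (theta : {rmorphism hecke_ring -> R[i]})
    (sp : {rmorphism H -> group_algebra R[i] gT}) : Prop :=
  [/\ is_scalar_specialisation theta,
      forall r h, sp (r *: h) = theta r *: sp h &
      forall x : B, sp (q (ga_elt hecke_ring x)) = ga_elt R[i] (pr x)].
End ReflectionGroup.

Definition conj_class (gT : finGroupType) : finType :=
  {C : {set gT} | C \in classes [set: gT]%SET}.

(* Main.v *)
Require Import Defs.
From HB Require Import structures.
From mathcomp Require Import all_boot all_order all_algebra all_fingroup.
From mathcomp Require Import all_character generic_quotient.
From mathcomp Require Import all_classical all_reals topology normedtype trigo.
From mathcomp Require Import fraction complex.
From mathcomp Require monalg mpoly.
(* The notations of multivariate polynomials are left out: they clash with
   others in use here. *)
Import (canonicals, coercions) monalg mpoly.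

Set Implicit Arguments.
Unset Strict Implicit.
Unset Printing Implicit Defensive.

Import Order.TTheory GRing.Theory Num.Theory.

Local Open Scope complex_scope.
Local Open Scope ring_scope.

(** Write F for the field over which HF is defined, and t for the extension of
    tau to HF; it is a symmetrising trace with the dual bases b_w, bd_w. Since
    x = sum_w t(x b_w) bd_w for every x, the map z |-> t(z _) identifies the
    centre of HF with the space T of trace functions on HF, and y_C corresponds
    to the trace function whose value at b_w is zeta_{w,C}. The theorem
    thus amounts to two facts: evaluation at the elements b_{v_C} is an
    isomorphism from T to F^Cl(W), and the irreducible characters form a basis
    of T.

    The first fact is a comparison with the group algebra, where u_{s,j} is
    specialised to a root of unity; it rests on the remark that a matrix over
    the ring of Laurent polynomials which is invertible after this
    specialisation is invertible over F (laurent_specialisation,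
    unitmx_specialised).
    - Injectivity (trace_eq0_on_classes). In the group algebra, w = g v_C g^-1
      is v_C plus the commutator of g v_C and g^-1. The same expression in H,
      with b_x in the place of x, specialises to w, so that these elements span
      HF; a trace function which vanishes at the b_{v_C} vanishes on them.
    - Surjectivity (class_pairing_unit). The elements
      z_C = sum_w b_w b_{v_C^-1} bd_w are central by the Casimir identity
      (casimir_commute), and t(z_C b_{v_D}) is the trace of the operator
      x |-> b_{v_D} x b_{v_C^-1}. It specialises to the number of w with
      v_D w v_C^-1 = w, that is, to the order of the centraliser of v_C if
      C = D, and to 0 otherwise. Hence the matrix of the t(z_C b_{v_D}) is
      invertible.

    As a consequence the y_C are combinations of the z_C, form a basis of the
    centre, and every central element has the form sum_w b_w h bd_w. This applies
    to 1, which turns the Casimir identity into Schur orthogonality with nonzero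
    Schur elements, so that the irreducible characters are linearly independent
    (irreducible_character_separated). It also shows that every trace function
    has the form a |-> sum_w t(a b_w h bd_w), the trace of left multiplication by
    a followed by the endomorphism x |-> x h of the left regular module.
    Decomposing this module into irreducible ones, on which endomorphisms are
    scalars, makes such a function a combination of irreducible characters
    (trace_endo_eq0). *)

(** * Bundling of linear maps *)
Lemma linear_bundled (R : nzRingType) (U V : lmodType R) (f : U -> V) :
  linear f -> exists g : {linear U -> V}, g =1 f.
Proof.
move=> fL; pose f_mixin := GRing.isLinear.Build R U V *:%R f fL.
pose g : {linear U -> V} := HB.pack f f_mixin.
by exists g.
Qed.

Lemma scalar_bundled (R : nzRingType) (U : lmodType R) (f : U -> R) :
  scalar f -> exists g : {scalar U}, g =1 f.
Proof.
move=> fL; pose f_mixin := GRing.isLinear.Build R U R *%R f fL.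
pose g : {scalar U} := HB.pack f f_mixin.
by exists g.
Qed.

(** * Dual bases and the Casimir identity *)

Section SymmetricAlgebra.
Variables (F : fieldType) (A : algType F) (I : finType) (b bd : I -> A).
Variable t : {scalar A}.
Hypothesis tC : forall x y : A, t (x * y) = t (y * x).
Hypothesis bE : forall x, x = \sum_i t (x * bd i) *: b i.

(** Expand each [bd i] on [b]: the coefficients are entries of a symmetric
    matrix, so that the sum regroups as the expansion of [x] on [b]. *)
Lemma dual_expansion x : x = \sum_i t (x * b i) *: bd i.
Proof.
under eq_bigr do rewrite [bd _]bE scaler_sumr.
rewrite exchange_big {1}[x]bE /=; apply: eq_bigr => l _.
under eq_bigr do rewrite scalerA.
rewrite -scaler_suml {1}[bd l]bE mulr_sumr linear_sum /=; congr (_ *: _).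
by apply: eq_bigr => i _; rewrite -scalerAr linearZ /= mulrC (tC (bd l)).
Qed.

Lemma form_nondegenerate x y : (forall a, t (x * a) = t (y * a)) -> x = y.
Proof.
move=> xy; rewrite (dual_expansion x) (dual_expansion y).
by under eq_bigr do rewrite xy.
Qed.

(** The relative trace of Higman and Gaschuetz. For a group algebra with the
    basis of group elements, it averages [h] under conjugation. *)
Definition higman h := \sum_i b i * h * bd i.

(** The Casimir element, the sum of the tensors of [b i] and [bd i], has the same
    product with [a] on both sides: the coefficients of [a * b i] on [b] and
    those of [bd j * a] on [bd] are the same numbers, because [t] is a trace.
    The bilinear map [f] stands for a linear map on the tensor square. *)
Lemma casimir_commute (V : lmodType F) (f : A -> A -> V) (a : A) :
    (forall y, linear (f^~ y)) -> (forall x, linear (f x)) ->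
  \sum_i f (a * b i) (bd i) = \sum_i f (b i) (bd i * a).
Proof.
move=> linl linr.
have fl y x : f x y = \sum_i t (x * bd i) *: f (b i) y.
  have [g gE] := linear_bundled (linl y).
  rewrite -gE {1}[x]bE linear_sum; apply: eq_bigr => i _.
  by rewrite linearZ /= gE.
have fr x y : f x y = \sum_i t (y * b i) *: f x (bd i).
  have [g gE] := linear_bundled (linr x).
  rewrite -gE {1}[y]dual_expansion linear_sum; apply: eq_bigr => i _.
  by rewrite linearZ /= gE.
under eq_bigr do rewrite fl.
rewrite exchange_big; apply: eq_bigr => j _ /=; rewrite fr.
by apply: eq_bigr => i _; rewrite -[bd j * a * b i]mulrA (tC (bd j)).
Qed.

Lemma higman_commute h a : a * higman h = higman h * a.
Proof.
rewrite mulr_sumr mulr_suml; under eq_bigr do rewrite !mulrA.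
under [RHS]eq_bigr do rewrite -mulrA.
apply: (@casimir_commute A (fun x y => x * h * y) a) => [y|x] c u v.
  by rewrite !mulrDl !scalerAl.
by rewrite mulrDr scalerAr.
Qed.

Lemma higman_sum (J : finType) (c : J -> F) (h : J -> A) :
  higman (\sum_j c j *: h j) = \sum_j c j *: higman (h j).
Proof.
rewrite /higman; under eq_bigr do rewrite mulr_sumr mulr_suml.
rewrite exchange_big; apply: eq_bigr => l _ /=; rewrite scaler_sumr.
by apply: eq_bigr => w _; rewrite -scalerAr -scalerAl.
Qed.

(** As [t (_ * bd i)] reads off the coefficient on [b i], the right-hand side is
    the trace of the operator sending [x] to [a * x * h]. *)
Lemma form_higman h a : t (higman h * a) = \sum_i t (a * b i * h * bd i).
Proof.
by rewrite mulr_suml linear_sum; apply: eq_bigr => i _; rewrite tC !mulrA.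
Qed.
End SymmetricAlgebra.

(** * Irreducible representations and their characters *)

Section Representations.
Variables (F : fieldType) (A : algType F).

Lemma lrmorphism_of_linear d (f : A -> 'M[F]_d.+1) :
    linear f -> f 1 = 1 -> {morph f : x y / x * y} ->
  exists rho : {lrmorphism A -> 'M[F]_d.+1}, rho =1 f.
Proof.
move=> fL f1 fM.
pose h := GRing.isLinear.Build F A 'M[F]_d.+1 *:%R f fL.
pose k := GRing.isMonoidMorphism.Build A 'M[F]_d.+1 f (conj f1 fM).
pose rho : {lrmorphism A -> 'M[F]_d.+1} := HB.pack f h k.
by exists rho.
Qed.

Lemma Schur d e (rho : {lrmorphism A -> 'M[F]_d.+1})
    (sigma : {lrmorphism A -> 'M[F]_e.+1}) (Y : 'M_(d.+1, e.+1)) :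
    irreducible_rep rho -> irreducible_rep sigma ->
    (forall a, rho a *m Y = Y *m sigma a) -> Y != 0 ->
  forall a, \tr (rho a) = \tr (sigma a).
Proof.
move=> irr_rho irr_sigma comm nzY.
have kerY : kermx Y = 0.
  have stab : stable_under rho (kermx Y).
    by move=> a; apply/sub_kermxP; rewrite -mulmxA comm mulmxA mulmx_ker mul0mx.
  case: (irr_rho _ stab) => // /row_fullP[B BY]; case/eqP: nzY.
  by rewrite -[Y]mul1mx -BY -mulmxA mulmx_ker mulmx0.
have imY : row_full Y.
  have stab : stable_under sigma <<Y>>%MS.
    move=> a; rewrite (eqmxMr _ (genmxE Y)) genmxE -comm; exact: submxMl.
  case: (irr_sigma _ stab) => [Y0|]; last by rewrite /row_full genmxE.
  by case/eqP: nzY; apply/eqP; rewrite -submx0 -Y0 genmxE.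
have freeY : row_free Y by rewrite -kermx_eq0 kerY.
have ed : d = e.
  by apply: succn_inj; rewrite -(eqP freeY) (eqP imY).
subst e => a.
have uY : Y \in unitmx by rewrite -row_full_unit.
by rewrite -[rho a](mulmxK uY) comm -mulmxA mxtrace_mulC mulmxKV.
Qed.

(** [P *m B] is the projection onto a direct summand, with [B] the inclusion of
    the summand and [P] the projection in the coordinates of the summand. *)
Lemma summand_rep d k (rho : {lrmorphism A -> 'M[F]_d.+1})
    (P : 'M_(d.+1, k.+1)) (B : 'M_(k.+1, d.+1)) :
    B *m P = 1%:M -> (forall a, P *m B *m rho a = rho a *m (P *m B)) ->
  exists2 rho1 : {lrmorphism A -> 'M[F]_k.+1},
    forall a, rho a *m P = P *m rho1 a & forall a, B *m rho a = rho1 a *m B.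
Proof.
move=> BP Prho.
have rhoP a : rho a *m P = P *m (B *m rho a *m P).
  by rewrite !mulmxA Prho -!mulmxA BP mulmx1.
have [|||rho1 rho1E] := @lrmorphism_of_linear k (fun a => B *m rho a *m P).
- by move=> c x y; rewrite linearP mulmxDr mulmxDl -scalemxAr -scalemxAl.
- by rewrite rmorph1 mulmx1.
- by move=> x y; rewrite rmorphM -[RHS]mulmxA -rhoP -!mulmxA.
exists rho1 => a; rewrite rho1E //.
by rewrite -[RHS]mulmxA -[RHS]mulmxA -Prho !mulmxA BP mul1mx.
Qed.

Lemma proj_mx_stable_comm d (rho : {lrmorphism A -> 'M[F]_d.+1}) U V :
    stable_under rho U -> stable_under rho V ->
    (U :&: V)%MS = 0 -> row_full (U + V)%MS ->
  forall a, proj_mx U V *m rho a = rho a *m proj_mx U V.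
Proof.
move=> stabU stabV UV0 UVfull a.
have sub1 : (1%:M <= U + V)%MS by rewrite submx_full.
have proj_sub X Y : (proj_mx (X : 'M[F]_d.+1) Y <= X)%MS.
  by rewrite -[proj_mx _ _]mul1mx proj_mx_sub.
rewrite -[in RHS](mul1mx (rho a)) -[in RHS](add_proj_mx UV0 sub1) !mul1mx.
rewrite !mulmxDl [proj_mx U V *m _ *m _]proj_mx_id //; last first.
  by apply: submx_trans (stabU a); rewrite submxMr.
rewrite proj_mx_0 ?addr0 //.
by apply: submx_trans (stabV a); rewrite submxMr.
Qed.

(** An endomorphism of an irreducible module is a scalar, so that the trace of
    its composite with [x] is a multiple of a character value. A reducible module
    splits as a direct sum, and only the diagonal blocks of [M], which are
    endomorphisms of the summands, contribute to the trace. *)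
Lemma trace_endo_eq0 (x : A) (ssA : split_semisimple_alg A) :
    (forall chi : A -> F, irreducible_character chi -> chi x = 0) ->
  forall d (rho : {lrmorphism A -> 'M[F]_d.+1}) M,
    (forall a, M *m rho a = rho a *m M) -> \tr (M *m rho x) = 0.
Proof.
move=> x0 d; have [m] := ubnP d; elim: m d => // m IH d le_dm rho M Mrho.
have [irr_rho | ] := pselect (irreducible_rep rho).
  have /is_scalar_mxP[c ->] := ssA.2 _ _ irr_rho _ Mrho.
  rewrite mul_scalar_mx mxtraceZ (x0 (fun a => \tr (rho a))) ?mulr0 //.
  by exists d, rho.
move=> /existsNP[U /not_implyP[stabU /not_orP[nzU notfullU]]].
have [V [stabV UV0 UVfull]] := ssA.1 _ _ _ stabU.
(* The contribution of a nonzero proper summand [U'] with complement [V']. *)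
have part (U' V' : 'M[F]_d.+1) : stable_under rho U' -> stable_under rho V' ->
    (U' :&: V')%MS = 0 -> row_full (U' + V')%MS -> U' != 0 -> ~~ row_full U' ->
  \tr (M *m rho x *m proj_mx U' V') = 0.
  move=> stabU' stabV' UV0' UVfull' nzU' nfU'.
  have [k rkU] : exists k, \rank U' = k.+1.
    by exists (\rank U').-1; rewrite prednK // lt0n mxrank_eq0.
  have lt_kd : (k < d)%N.
    rewrite -ltnS -rkU ltn_neqAle rank_leq_col andbT; exact: nfU'.
  have [B BU] : exists B : 'M[F]_(k.+1, d.+1), (B :=: U')%MS.
    by case: _ / rkU; exists (row_base U'); exact: eq_row_base.
  have freeB : row_free B by rewrite /row_free BU rkU.
  have [P PB BP] : exists2 P, P *m B = proj_mx U' V' & B *m P = 1%:M.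
    exists (proj_mx U' V' *m pinvmx B).
      by rewrite mulmxKpV // BU -[proj_mx _ _]mul1mx proj_mx_sub.
    by rewrite mulmxA proj_mx_id ?BU // mulmxVp.
  have Prho a : P *m B *m rho a = rho a *m (P *m B).
    by rewrite PB; apply: proj_mx_stable_comm.
  have [rho1 rhoP Brho] := summand_rep BP Prho.
  rewrite -PB mulmxA mxtrace_mulC -[M *m rho x *m P]mulmxA rhoP !mulmxA.
  apply: (IH k (leq_trans lt_kd le_dm) rho1 (B *m M *m P)) => a.
  by rewrite -mulmxA -rhoP !mulmxA -Brho -!(mulmxA B) Mrho.
have nzV : V != 0.
  apply/eqP => V0; apply: notfullU; rewrite -[row_full U]/(\rank U == _).
  by move: UVfull; rewrite V0 /row_full addsmx0.
have nfV : ~~ row_full V.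
  apply/negP => fullV; apply: nzU; apply/eqP; rewrite -submx0 -UV0.
  by rewrite sub_capmx submx_refl submx_full.
have UVfull1 : (1%:M <= U + V)%MS by rewrite submx_full.
rewrite -[M *m rho x]mulmx1 -(add_proj_mx UV0 UVfull1) !mul1mx mulmxDr mxtraceD.
rewrite (part U V) //; [|exact/eqP|exact/negP].
rewrite add0r; apply: part nzV nfV => //; first by rewrite capmxC.
by rewrite addsmxC.
Qed.

Section Separation.
Variables (I : finType) (b bd : I -> A) (t : {scalar A}).
Hypothesis tC : forall x y : A, t (x * y) = t (y * x).
Hypothesis bE : forall x, x = \sum_i t (x * bd i) *: b i.
Hypothesis splitA : split_alg A.
Hypothesis higman1 : exists h, higman b bd h = 1.

(** Schur orthogonality. The Casimir identity makes [Y sigma X] below an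
    intertwiner from [rho] to [sigma], hence zero if the characters differ, and a
    scalar matrix if [sigma] is [rho]. The hypothesis on [1] ensures that this
    scalar is nonzero for some [X]. The separating element [z k p] has a matrix
    coefficient of [rho] as coordinates on [bd], so that its image under [sigma]
    has entries of the matrices [Y sigma X]. *)
Lemma irreducible_character_separated (chi : A -> F) : irreducible_character chi ->
  exists2 x, chi x != 0 &
    forall psi : A -> F, irreducible_character psi -> psi <> chi -> psi x = 0.
Proof.
case=> d [rho [irr_rho chiE]].
pose Y e (sigma : {lrmorphism A -> 'M[F]_e.+1}) (X : 'M_(d.+1, e.+1)) :=
  \sum_i rho (b i) *m X *m sigma (bd i).
have YC e sigma X a : rho a *m Y e sigma X = Y e sigma X *m sigma a.
  rewrite mulmx_sumr mulmx_suml.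
  under eq_bigr do rewrite !mulmxA -[rho a *m rho _](rmorphM rho).
  under [RHS]eq_bigr do rewrite -mulmxA -[sigma _ *m _](rmorphM sigma).
  pose f x y := rho x *m X *m sigma y.
  apply: (casimir_commute tC bE (f := f)) => [y|x] c u v; rewrite /f.
    by rewrite linearP !mulmxDl !scalemxAl.
  by rewrite linearP mulmxDr scalemxAr.
pose z i p := \sum_w rho (b w) i p *: bd w.
have zE e (sigma : {lrmorphism A -> 'M[F]_e.+1}) i p :
    \tr (sigma (z i p)) = \sum_k Y e sigma (delta_mx p k) i k.
  rewrite /mxtrace linear_sum; apply: eq_bigr => l _; rewrite !summxE.
  apply: eq_bigr => w _; rewrite linearZ [LHS]mxE.
  (* [delta_mx p l] is a column times a row, which isolates one entry. *)
  rewrite -(mul_delta_mx (0 : 'I_1)) mulmxA -colE -mulmxA -rowE mxE big_ord1.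
  by rewrite !mxE.
have Yscal X : is_scalar_mx (Y d rho X) by apply: (splitA irr_rho) => a; rewrite YC.
have [p [k nzY]] : exists p k, Y d rho (delta_mx p k) != 0.
  have [h h1] := higman1.
  have Yh : Y d rho (rho h) = 1.
    rewrite -[RHS](rmorph1 rho) -h1 [RHS](linear_sum rho).
    by apply: eq_bigr => i _; rewrite -[RHS]/(rho (b i * h * bd i)) !rmorphM.
  apply/not_existsP => Y0; have /eqP[] := oner_neq0 'M[F]_d.+1.
  have Ysum X : Y d rho X = \sum_p \sum_k X p k *: Y d rho (delta_mx p k).
    rewrite {1}[X]matrix_sum_delta /Y.
    under eq_bigr do rewrite mulmx_sumr mulmx_suml.
    rewrite exchange_big; apply: eq_bigr => p _ /=.
    under eq_bigr do rewrite mulmx_sumr mulmx_suml.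
    rewrite exchange_big; apply: eq_bigr => k _ /=; rewrite scaler_sumr.
    by apply: eq_bigr => w _; rewrite -scalemxAr -scalemxAl.
  rewrite -Yh Ysum big1 // => p _; rewrite big1 // => k _.
  have /forallNP/(_ k)/negP := Y0 p; rewrite negbK => /eqP ->.
  exact: scaler0.
have chiz e (sigma : {lrmorphism A -> 'M[F]_e.+1}) : irreducible_rep sigma ->
    (exists a, \tr (rho a) != \tr (sigma a)) -> \tr (sigma (z k p)) = 0.
  move=> irr_sigma [a neq]; rewrite zE big1 // => l _.
  have [-> | nzYl] := eqVneq (Y e sigma (delta_mx p l)) 0; first by rewrite mxE.
  by rewrite (Schur irr_rho irr_sigma (YC _ _ _) nzYl) eqxx in neq.
exists (z k p).
  rewrite chiE zE (bigD1 k) //= big1 => [|l lk].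
    have /is_scalar_mxP[c Yc] := Yscal (delta_mx p k).
    rewrite Yc mxE eqxx addr0; apply: contraNneq nzY; rewrite Yc mulr1n => ->.
    by rewrite raddf0.
  have /is_scalar_mxP[c ->] := Yscal (delta_mx p l).
  by rewrite mxE eq_sym (negPf lk).
move=> psi [e [sigma [irr_sigma psiE]]] neq; rewrite psiE chiz //.
apply: contra_notP neq => /forallNP eq_tr; apply/funext => a.
by rewrite chiE psiE; have /negP := eq_tr a; rewrite negbK => /eqP.
Qed.
End Separation.

(** The hypotheses say that the irreducible characters are linearly independent,
    that they are determined by their values at the points [e j], and that these
    values satisfy no common linear relation. The rows of values of distinct
    characters are therefore independent, which bounds the length of a list of
    such characters by [#|J|]; in a list of maximal length all characters occur,
    so that its matrix of values has independent columns as well. *)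
Lemma enumerate_irreducible_characters (J : finType) (e : J -> A) (g : J -> A -> F) :
    (forall chi : A -> F, irreducible_character chi ->
       exists2 x, chi x != 0 &
         forall psi : A -> F, irreducible_character psi -> psi <> chi -> psi x = 0) ->
    (forall chi : A -> F, irreducible_character chi ->
       forall x, chi x = \sum_j chi (e j) * g j x) ->
    (forall c : J -> F, (forall chi : A -> F, irreducible_character chi ->
       \sum_j c j * chi (e j) = 0) -> forall j, c j = 0) ->
  exists chi : J -> A -> F, enumerates_Irr chi /\
    \matrix_(i < #|J|, j < #|J|) chi (enum_val i) (e (enum_val j)) \in unitmx.
Proof.
move=> sep span faithful.
pose listed k := exists chi : 'I_k -> A -> F,
  injective chi /\ forall i, irreducible_character (chi i).
pose X k (chi : 'I_k -> A -> F) :=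
  \matrix_(i < k, j < #|J|) chi i (e (enum_val j)).
have free k (chi : 'I_k -> A -> F) : injective chi ->
    (forall i, irreducible_character (chi i)) -> row_free (X k chi).
  move=> inj irr; rewrite -kermx_eq0; apply/eqP/row_matrixP => i; rewrite row0.
  have /sub_kermxP := row_sub i (kermx (X k chi)); move: (row i _) => u uX0.
  apply/rowP => l; rewrite mxE; have [x nz sepx] := sep _ (irr l).
  have : \sum_m u 0 m * chi m x = 0.
    under eq_bigr do rewrite (span _ (irr _)) mulr_sumr.
    rewrite exchange_big big1 // => j _; under eq_bigr do rewrite mulrA.
    rewrite -mulr_suml; have /rowP/(_ (enum_rank j)) := uX0.
    rewrite !mxE; under eq_bigr do rewrite mxE enum_rankK.
    by move=> ->; rewrite mul0r.
  rewrite (bigD1 l) //= big1 ?addr0 => [|m ml].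
    by move/eqP; rewrite mulf_eq0 (negPf nz) orbF => /eqP.
  by rewrite sepx ?mulr0 // => /inj/eqP; rewrite (negPf ml).
have listed0 : exists k, `[< listed k >].
  by exists 0; apply/asboolP; exists (fun _ _ => 0); split=> [[]|[]].
have bound k : `[< listed k >] -> (k <= #|J|)%N.
  move=> /asboolP[chi [inj irr]].
  by rewrite -(eqP (free k chi inj irr)) rank_leq_col.
have [k /asboolP[chi [inj irr]] kmax] := ex_maxnP listed0 bound.
have all_irr (psi : A -> F) : irreducible_character psi -> exists i, psi = chi i.
  move=> irr_psi; apply: contrapT => /forallNP new.
  suff /kmax : `[< listed k.+1 >] by rewrite ltnn.
  apply/asboolP; exists (fun i => oapp chi psi (unlift ord0 i)); split=> [i j|i].
    case: unliftP => [i'|] ->; case: unliftP => [j'|] -> //=.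
    - by move/inj ->.
    - by move/esym/new.
    - by move/new.
  by case: (unlift ord0 i) => [i'|]; [exact: irr|].
have full : row_full (X k chi).
  rewrite -cokermx_eq0; apply/eqP/matrixP => r l; rewrite [RHS]mxE.
  rewrite -[r]enum_valK.
  apply: (faithful (fun j => cokermx (X k chi) (enum_rank j) l) _ (enum_val r)).
  move=> psi /all_irr[m ->].
  have /matrixP/(_ m l) := mulmx_coker (X k chi); rewrite [RHS]mxE [LHS]mxE => XK0.
  rewrite -[RHS]XK0 (reindex (fun i : 'I_#|J| => enum_val i)) /=; last first.
    exact/onW_bij/enum_val_bij.
  by apply: eq_bigr => j _; rewrite [X k chi m j]mxE enum_valK mulrC.
have ek : k = #|J| by rewrite -(eqP (free k chi inj irr)); apply/eqP.
subst k; exists (fun j => chi (enum_rank j)); split.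
  split=> [i j /inj/enum_rank_inj //||psi /all_irr[i ->]] //.
  by exists (enum_val i); rewrite enum_valK.
have -> : \matrix_(i, j) chi (enum_rank (enum_val i)) (e (enum_val j)) = X _ chi.
  by apply/matrixP => i j; rewrite !mxE enum_valK.
by rewrite -row_free_unit free.
Qed.
End Representations.

(** * The centre of a split semisimple symmetric algebra *)

Section Centre.
Variables (F : fieldType) (A : algType F) (I : finType) (b bd : I -> A).
Variable t : {scalar A}.
Hypothesis tC : forall x y : A, t (x * y) = t (y * x).
Hypothesis bE : forall x, x = \sum_i t (x * bd i) *: b i.
Variables (J : finType) (e u : J -> A).
Hypothesis trace_eq0 : forall f : {scalar A},
  (forall x y : A, f (x * y) = f (y * x)) ->
  (forall j, f (e j) = 0) -> forall x, f x = 0.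
Hypothesis pairing_unit :
  \matrix_(i < #|J|, j < #|J|)
    t (higman b bd (u (enum_val i)) * e (enum_val j)) \in unitmx.

Lemma dual_central_family : exists y : J -> A,
  (forall i j, t (y i * e j) = (i == j)%:R) /\
  (forall i, exists h, y i = higman b bd h).
Proof.
have := pairing_unit; set P := (X in X \in unitmx) => uP.
exists (fun i => \sum_l invmx P (enum_rank i) l *: higman b bd (u (enum_val l))).
split=> [i j|i].
  transitivity ((invmx P *m P) (enum_rank i) (enum_rank j)).
    rewrite mulr_suml linear_sum !mxE; apply: eq_bigr => l _.
    by rewrite !mxE enum_rankK -scalerAl linearZ.
  by rewrite mulVmx // mxE (inj_eq enum_rank_inj).
by exists (\sum_l invmx P (enum_rank i) l *: u (enum_val l)); rewrite higman_sum.
Qed.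

Variable y : J -> A.
Hypothesis y_dual : forall i j, t (y i * e j) = (i == j)%:R.
Hypothesis y_higman : forall i, exists h, y i = higman b bd h.

Lemma y_central i : is_central (y i).
Proof. by have [h -> a] := y_higman i; rewrite (higman_commute tC bE). Qed.

(** Both sides are trace functions and agree at the points [e j]. *)
Lemma trace_expansion (f : {scalar A}) : (forall x y : A, f (x * y) = f (y * x)) ->
  forall x, f x = \sum_j f (e j) * t (y j * x).
Proof.
move=> fC x; apply/eqP; rewrite -subr_eq0; apply/eqP.
pose g x := f x - \sum_j f (e j) * t (y j * x).
have gL : scalar g.
  move=> c a a'; rewrite /g linearP /= mulrBr -addrACA; congr (_ + _).
  rewrite mulr_sumr -sumrN -sumrN -sumrN -big_split; apply: eq_bigr => j _ /=.
  by rewrite mulrDr linearD -scalerAr linearZ /= mulrDr opprD mulrCA.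
have [g' g'E] := scalar_bundled gL.
rewrite -[LHS]/(g x) -g'E; apply: trace_eq0 => [a a'|i]; rewrite !g'E /g.
  rewrite fC; congr (_ - _); apply: eq_bigr => j _.
  by rewrite mulrA tC mulrA -(y_central j) mulrA.
rewrite (bigD1 i) //= y_dual eqxx mulr1 big1 ?addr0 ?subrr // => j ji.
by rewrite y_dual (negPf ji) mulr0.
Qed.

(** Central elements are the representatives of trace functions with respect to
    the form, so this is the expansion of the trace function [t (z * _)]. *)
Lemma central_expansion z : is_central z -> z = \sum_j t (z * e j) *: y j.
Proof.
move=> zC; apply: (form_nondegenerate tC bE) => a.
have fL : scalar (fun a => t (z * a)).
  by move=> c a1 a2; rewrite mulrDr linearD -scalerAr linearZ.
have [f fE] := scalar_bundled fL.
rewrite -fE (trace_expansion (f := f)) => [|c d]; last first.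
  by rewrite !fE mulrA tC mulrA -zC mulrA.
rewrite mulr_suml linear_sum; apply: eq_bigr => j _.
by rewrite fE -scalerAl linearZ.
Qed.

Lemma central_basis : is_basis_of (@is_central A) y.
Proof.
split=> [|z zC]; first exact: y_central.
exists [ffun j => t (z * e j)]; split=> [|c ->].
  by rewrite {1}(central_expansion zC); apply: eq_bigr => j _; rewrite ffunE.
apply/ffunP => j; rewrite ffunE mulr_suml linear_sum (bigD1 j) //= big1 => [|i ij].
  by rewrite addr0 -scalerAl linearZ /= y_dual eqxx mulr1.
by rewrite -scalerAl linearZ /= y_dual (negPf ij) mulr0.
Qed.

(** The relative trace is onto the centre, which says that the algebra is
    separable. *)
Lemma higman_one : exists h, higman b bd h = 1.
Proof.
have [k kE] : exists k : J -> A, forall j, y j = higman b bd (k j).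
  by exists (fun j => projT1 (cid (y_higman j))) => j; case: cid.
exists (\sum_j t (1 * e j) *: k j).
rewrite [RHS]central_expansion; last by move=> a; rewrite mul1r mulr1.
by rewrite higman_sum; apply: eq_bigr => j _; rewrite kE.
Qed.

Hypothesis b_bd : forall i j, t (b i * bd j) = (i == j)%:R.

(** [rho] is the left regular representation and [M] is right multiplication by
    [h], an endomorphism of the left regular module. *)
Lemma higman_form_as_trace h : exists d (rho : {lrmorphism A -> 'M[F]_d.+1}) M,
  (forall a, M *m rho a = rho a *m M) /\
  forall a, t (higman b bd h * a) = \tr (M *m rho a).
Proof.
have [d cardI] : exists d, #|I| = d.+1.
  exists #|I|.-1; rewrite prednK // lt0n; apply/negP => /eqP/card0_eq I0.
  have /eqP[] := oner_neq0 A; rewrite [1]bE big1 // => i.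
  by have := I0 i; rewrite inE.
pose ev (i : 'I_d.+1) := enum_val (cast_ord (esym cardI) i).
have ev_bij : bijective ev.
  exists (fun i => cast_ord cardI (enum_rank i)) => i; rewrite /ev.
    by rewrite enum_valK cast_ordKV.
  by rewrite cast_ordK enum_rankK.
pose mx (f : A -> A) := \matrix_(u, w) t (f (b (ev w)) * bd (ev u)) : 'M[F]_d.+1.
have mxM (f g : A -> A) : linear f -> mx f *m mx g = mx (f \o g).
  move=> fL; have fE x : f x = \sum_i t (x * bd i) *: f (b i).
    have [f' f'E] := linear_bundled fL.
    rewrite -f'E {1}[x]bE linear_sum; apply: eq_bigr => i _.
    by rewrite linearZ /= f'E.
  apply/matrixP => i j; rewrite !mxE /= fE mulr_suml linear_sum.
  rewrite (reindex ev) /=; last exact: onW_bij.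
  by apply: eq_bigr => l _; rewrite !mxE -scalerAl linearZ /= mulrC.
have lmulL (a : A) : linear (fun x : A => a * x).
  by move=> c x x' /=; rewrite mulrDr -scalerAr.
have rmulL (a : A) : linear (fun x : A => x * a).
  by move=> c x x' /=; rewrite mulrDl -scalerAl.
have [|||rho rhoE] := @lrmorphism_of_linear F A d (fun a => mx ( *%R a)).
- move=> c x x'; apply/matrixP => i j.
  by rewrite !mxE !mulrDl linearD -!scalerAl linearZ.
- apply/matrixP => i j; rewrite !mxE mul1r b_bd (inj_eq (bij_inj ev_bij)).
  by rewrite eq_sym.
- move=> x x'; rewrite -[RHS]/(_ *m _) mxM //; congr (mx _); apply/funext => a /=.
  by rewrite mulrA.
exists d, rho, (mx (fun a => a * h)); split=> a; rewrite rhoE.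
  rewrite (mxM _ _ (rmulL h)) (mxM _ _ (lmulL a)); congr (mx _).
  by apply/funext => x /=; rewrite mulrA.
rewrite (mxM _ _ (rmulL h)) form_higman // (reindex ev) /=; last exact: onW_bij.
by apply: eq_bigr => i _; rewrite mxE.
Qed.

Hypothesis ssA : split_semisimple_alg A.

Lemma irreducible_character_expansion (chi : A -> F) : irreducible_character chi ->
  forall x, chi x = \sum_j chi (e j) * t (y j * x).
Proof.
case=> d [rho [irr_rho chiE]] x.
have trL : scalar (fun a => \tr (rho a)).
  by move=> c a a'; rewrite linearP /= linearP.
have [f fE] := scalar_bundled trL.
rewrite chiE -fE (trace_expansion (f := f)) => [|a a']; last first.
  by rewrite !fE !rmorphM mxtrace_mulC.
by apply: eq_bigr => j _; rewrite fE chiE.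
Qed.

(** The hypothesis says that all irreducible characters vanish at
    [\sum_i c i *: e i]. All trace functions then vanish there, and [t (y j * _)]
    reads off [c j]. *)
Lemma irreducible_characters_faithful (c : J -> F) :
    (forall chi : A -> F, irreducible_character chi -> \sum_j c j * chi (e j) = 0) ->
  forall j, c j = 0.
Proof.
move=> c0 j; pose x := \sum_i c i *: e i.
have x0 (chi : A -> F) : irreducible_character chi -> chi x = 0.
  move=> irr_chi; rewrite -[RHS](c0 _ irr_chi); case: irr_chi => d [rho [_ chiE]].
  rewrite chiE !linear_sum; apply: eq_bigr => i _ /=.
  by rewrite linearZ mxtraceZ chiE.
have <- : t (y j * x) = c j.
  rewrite mulr_sumr linear_sum (bigD1 j) //= big1 ?addr0 => [|i ij].
    by rewrite -scalerAr linearZ /= y_dual eqxx mulr1.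
  by rewrite -scalerAr linearZ /= y_dual eq_sym (negPf ij) mulr0.
have [h ->] := y_higman j; have [d [rho [M [Mrho ->]]]] := higman_form_as_trace h.
exact: trace_endo_eq0 Mrho.
Qed.
End Centre.

(** The coefficients are [zeta w j = t (y j * b w)], where the central elements
    [y j] are dual to the points [e j]. *)
Theorem symmetric_algebra_centre (F : fieldType) (A : algType F)
    (I J : finType) (b bd : I -> A) (t : {scalar A}) (e u : J -> A) :
    (forall x y : A, t (x * y) = t (y * x)) ->
    (forall x, x = \sum_i t (x * bd i) *: b i) ->
    (forall i j, t (b i * bd j) = (i == j)%:R) ->
    (forall f : {scalar A}, (forall x y : A, f (x * y) = f (y * x)) ->
       (forall j, f (e j) = 0) -> forall x, f x = 0) ->
    \matrix_(i < #|J|, j < #|J|)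
      t (higman b bd (u (enum_val i)) * e (enum_val j)) \in unitmx ->
    split_semisimple_alg A ->
  (exists chi : J -> A -> F, enumerates_Irr chi /\
     \matrix_(i < #|J|, j < #|J|) chi (enum_val i) (e (enum_val j)) \in unitmx) /\
  exists zeta : I -> J -> F,
    let decomposes (z : I -> J -> F) :=
      forall chi : A -> F, irreducible_character chi ->
      forall w, chi (b w) = \sum_j z w j * chi (e j) in
    [/\ decomposes zeta,
        forall zeta', decomposes zeta' -> forall w j, zeta' w j = zeta w j &
        is_basis_of (@is_central A) (fun j => \sum_w zeta w j *: bd w)].
Proof.
move=> tC bE b_bd e_sep Punit ssA.
have [y [y_dual y_higman]] := dual_central_family Punit.
have expand := irreducible_character_expansion tC bE e_sep y_dual y_higman.
have faithful := irreducible_characters_faithful tC bE y_dual y_higman b_bd ssA.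
split.
  apply: (enumerate_irreducible_characters (g := fun j x => t (y j * x))) => //.
  apply: (irreducible_character_separated tC bE ssA.2).
  exact: (higman_one tC bE e_sep y_dual y_higman).
have zetaP (chi : A -> F) : irreducible_character chi ->
    forall w, chi (b w) = \sum_j t (y j * b w) * chi (e j).
  by move=> irr_chi w; rewrite expand //; apply: eq_bigr => j _; rewrite mulrC.
exists (fun w j => t (y j * b w)); split=> // [z zP w j|].
  apply/eqP; rewrite -subr_eq0; apply/eqP; move: j.
  apply: (faithful (fun j => z w j - t (y j * b w))) => chi irr_chi.
  under eq_bigr do rewrite mulrBl.
  by rewrite sumrB -zP // -zetaP // subrr.
have -> : (fun j => \sum_w t (y j * b w) *: bd w) = y.
  by apply/funext => j; rewrite -(dual_expansion tC bE).
exact: (central_basis tC bE e_sep y_dual y_higman).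
Qed.

(** * Extension of scalars of a symmetrising trace *)

Section ScalarExtension.
Variables (L : comNzRingType) (F : fieldType) (phi : {rmorphism L -> F}).
Variables (H : algType L) (HF : algType F) (iota : {rmorphism H -> HF}).
Hypothesis HF_ext : is_extension_of_scalars phi iota.
Variables (tau : {scalar H}) (I : finType) (b bd : I -> H).
Hypothesis tauC : forall x y, tau (x * y) = tau (y * x).
Hypothesis bE : forall h, h = \sum_i tau (h * bd i) *: b i.

Lemma extend_trace_form : exists tF : {scalar HF},
  [/\ forall h, tF (iota h) = phi (tau h),
      forall x y : HF, tF (x * y) = tF (y * x) &
      forall x, x = \sum_i tF (x * iota (bd i)) *: iota (b i)].
Proof.
have [iotaZ univ] := HF_ext.
have gB : zmod_morphism (fun h : H => phi (tau h) : F^o).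
  by move=> x y; rewrite !raddfB.
pose g1 := GRing.isZmodMorphism.Build H F^o _ gB.
pose g : {additive H -> F^o} := HB.pack (fun h : H => phi (tau h) : F^o) g1.
have [tF tFE] : exists tF : {scalar HF}, forall h, tF (iota h) = phi (tau h).
  have [r h|f fE _] := univ F^o g; first by rewrite /g /= linearZ /= rmorphM.
  have fL : scalar (f : HF -> F) by move=> c x y; rewrite linearP.
  by have [tF tFE] := scalar_bundled fL; exists tF => h; rewrite tFE fE.
have tFbE x : x = \sum_i tF (x * iota (bd i)) *: iota (b i).
  have [E EE] : exists E : {linear HF -> HF},
      forall x, E x = \sum_i tF (x * iota (bd i)) *: iota (b i).
    apply: linear_bundled => c y z; rewrite scaler_sumr -big_split.
    apply: eq_bigr => i _ /=.
    by rewrite mulrDl linearD -scalerAl linearZ scalerDl scalerA.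
  (* Both [E] and the identity extend [iota]. *)
  have [//|id' _ uniq] := univ HF iota.
  rewrite -EE uniq => [|h]; first by rewrite -(uniq idfun).
  rewrite EE [in RHS](bE h) raddf_sum; apply: eq_bigr => i _ /=.
  by rewrite -rmorphM tFE iotaZ.
exists tF; split=> // x y.
rewrite (tFbE x) (tFbE y) !mulr_suml !linear_sum.
under eq_bigr do rewrite mulr_sumr linear_sum.
under [RHS]eq_bigr do rewrite mulr_sumr linear_sum.
rewrite exchange_big; apply: eq_bigr => i _; apply: eq_bigr => j _ /=.
rewrite -!scalerAl -!scalerAr !linearZ /= mulrCA; congr (_ * (_ * _)).
by rewrite -!rmorphM !tFE tauC.
Qed.
End ScalarExtension.

Lemma basis_dual_expansion (L : comNzRingType) (H : algType L) (tau : {scalar H})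
    (I : finType) (b bd : I -> H) :
  is_basis b -> dual_basis tau b bd -> forall h, h = \sum_i tau (h * bd i) *: b i.
Proof.
move=> [_ b_span] b_bd h; have [c [hE _]] := b_span h Logic.I.
rewrite {1}hE; apply: eq_bigr => i _; congr (_ *: _).
rewrite hE mulr_suml linear_sum (bigD1 i) //= big1 => [|j ji].
  by rewrite -scalerAl linearZ /= b_bd eqxx mulr1 addr0.
by rewrite -scalerAl linearZ /= b_bd (negPf ji) mulr0.
Qed.

(** * Comparison with the group algebra *)

Section Specialisation.
Variables (L : comNzRingType) (F : fieldType) (k : numFieldType).
Variables (phi : {rmorphism L -> F}) (theta : {rmorphism L -> k}).
Hypothesis phi_theta : forall r, phi r = 0 -> theta r = 0.
Variables (gT : finGroupType) (H : algType L).
Variable sp : {rmorphism H -> group_algebra k gT}.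
Hypothesis spZ : forall r h, sp (r *: h) = theta r *: sp h.
Variables (tau : {scalar H}) (b bd : gT -> H).
Hypothesis bE : forall h, h = \sum_i tau (h * bd i) *: b i.
Hypothesis spb : forall w, sp (b w) = ga_elt k w.

Lemma unitmx_specialised m (M : 'M[L]_m) :
  map_mx theta M \in unitmx -> map_mx phi M \in unitmx.
Proof.
rewrite !unitmxE !det_map_mx !unitfE; apply: contra_neq.
exact: phi_theta.
Qed.

Lemma coord_specialised h w :
  theta (tau (h * bd w)) = monalg.mcoeff w (sp h).
Proof.
rewrite {2}[h]bE raddf_sum raddf_sum (bigD1 w) //= big1 ?addr0 => [|u uw].
  by rewrite spZ spb monalg.mcoeffZ monalg.mcoeffU eqxx mulr1.
by rewrite spZ spb monalg.mcoeffZ monalg.mcoeffU (negPf uw) mulr0.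
Qed.

Lemma ga_eltM (x y : gT) : ga_elt k x * ga_elt k y = ga_elt k (x * y)%g.
Proof. by rewrite -[LHS]/(ga_mul _ _) ga_mulUU mulr1. Qed.

Variables (v : conj_class gT -> gT).
Hypothesis v_rep : forall C, v C \in val C.

Lemma conj_rep w : exists C g, w = (g * v C * g^-1)%g.
Proof.
have wC : (w ^: [set: gT])%g \in classes [set: gT]%SET by rewrite mem_classes ?inE.
pose C : conj_class gT := exist (fun X : {set gT} => X \in classes [set: gT]) _ wC.
have /imsetP[g _ vC] := v_rep C; exists C, g; rewrite vC.
by rewrite conjgE !mulgA mulgV mul1g mulgK.
Qed.

Lemma conj_rep_inj C D w : v D = (w * v C * w^-1)%g -> C = D.
Proof.
move=> vDC; apply: val_inj.
have cl (E : conj_class gT) : val E = (v E ^: [set: gT])%g.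
  have /imsetP[x _ Ex] := valP E; have := v_rep E.
  by rewrite Ex => /class_eqP ->.
rewrite !cl vDC; apply/esym/class_eqP/imsetP; exists w^-1%g; rewrite ?inE //.
by rewrite conjgE invgK mulgA.
Qed.

(** The coordinates of [h] on [b] specialise to those of [sp h], so the sum is the
    trace of a permutation of [gT], which counts fixed points. *)
Lemma pairing_specialised C D :
  theta (\sum_w tau (b (v D) * b w * b ((v C)^-1)%g * bd w)) =
    #|[set w | v D == (w * v C * w^-1)%g]|%:R.
Proof.
rewrite raddf_sum -sum1_card natr_sum [RHS]big_mkcond; apply: eq_bigr => w _ /=.
rewrite coord_specialised !rmorphM !spb !ga_eltM monalg.mcoeffU inE.
suff -> : (v D * w * (v C)^-1 == w)%g = (v D == w * v C * w^-1)%g by case: ifP.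
by rewrite -(inj_eq (mulIg (v C))) -(inj_eq (mulIg w^-1%g)) mulgKV mulgK.
Qed.

Variables (HF : algType F) (iota : {rmorphism H -> HF}) (tF : {scalar HF}).
Hypothesis iotaZ : forall r h, iota (r *: h) = phi r *: iota h.
Hypothesis tF_iota : forall h, tF (iota h) = phi (tau h).
Hypothesis tFC : forall x y : HF, tF (x * y) = tF (y * x).
Hypothesis tFE : forall x, x = \sum_w tF (x * iota (bd w)) *: iota (b w).

(** The element of [H] lifting [w] is a class representative plus a commutator,
    on which [f] vanishes. The matrix of these lifts on [b] specialises to the
    identity, so that the lifts span [HF]. *)
Lemma trace_eq0_on_classes (f : {scalar HF}) :
    (forall x y : HF, f (x * y) = f (y * x)) ->
    (forall C, f (iota (b (v C))) = 0) -> forall x, f x = 0.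
Proof.
move=> fC f0.
have lift w : exists h, sp h = ga_elt k w /\ f (iota h) = 0.
  have [C [g ->]] := conj_rep w.
  exists (b (v C) + (b (g * v C) * b g^-1 - b g^-1 * b (g * v C)))%g.
  split; last by rewrite rmorphD rmorphB !rmorphM linearD linearB f0 fC subrr addr0.
  rewrite rmorphD rmorphB !rmorphM !spb !ga_eltM mulKg.
  by rewrite addrC subrK.
have [h hP] : exists h : gT -> H, forall w,
    sp (h w) = ga_elt k w /\ f (iota (h w)) = 0.
  by exists (fun w => projT1 (cid (lift w))) => w; case: cid.
pose M := \matrix_(i < #|gT|, j < #|gT|) tau (h (enum_val i) * bd (enum_val j)).
have uM : map_mx phi M \in unitmx.
  apply: unitmx_specialised; rewrite (_ : map_mx theta M = 1%:M) ?unitmx1 //.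
  apply/matrixP => i j; rewrite !mxE coord_specialised (hP _).1 monalg.mcoeffU.
  by rewrite (inj_eq enum_val_inj).
have fb : map_mx phi M *m \col_j f (iota (b (enum_val j))) = 0.
  apply/colP => i; rewrite !mxE -[RHS](hP (enum_val i)).2 [h _ in RHS]bE.
  rewrite !raddf_sum [RHS](reindex (fun i : 'I_#|gT| => enum_val i)) /=; last first.
    exact/onW_bij/enum_val_bij.
  by apply: eq_bigr => j _; rewrite !mxE iotaZ linearZ.
have {}fb w : f (iota (b w)) = 0.
  have : \col_(j < #|gT|) f (iota (b (enum_val j))) = 0.
    by rewrite -[LHS](mulKmx uM) fb mulmx0.
  by move/colP/(_ (enum_rank w)); rewrite !mxE enum_rankK.
by move=> x; rewrite [x]tFE linear_sum big1 // => w _; rewrite linearZ /= fb mulr0.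
Qed.

(** The matrix specialises to the diagonal matrix of the orders of the
    centralisers of the class representatives. *)
Lemma class_pairing_unit :
  \matrix_(i < #|{: conj_class gT}|, j < #|{: conj_class gT}|)
    tF (higman (iota \o b) (iota \o bd) (iota (b ((v (enum_val i))^-1)%g))
        * iota (b (v (enum_val j)))) \in unitmx.
Proof.
pose P := \matrix_(i < #|{: conj_class gT}|, j < #|{: conj_class gT}|)
  \sum_w tau (b (v (enum_val j)) * b w * b ((v (enum_val i))^-1)%g * bd w).
suff <- : map_mx phi P = \matrix_(i, j)
    tF (higman (iota \o b) (iota \o bd) (iota (b ((v (enum_val i))^-1)%g))
        * iota (b (v (enum_val j)))).
  apply: unitmx_specialised.
  suff -> : map_mx theta P = diag_mx (\row_i
      #|[set w | v (enum_val i) == (w * v (enum_val i) * w^-1)%g]|%:R).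
    rewrite unitmxE det_diag unitfE; apply/prodf_neq0 => i _.
    rewrite mxE pnatr_eq0 -lt0n card_gt0; apply/set0Pn; exists 1%g.
    by rewrite inE invg1 mulg1 mul1g.
  apply/matrixP => i j; rewrite !mxE pairing_specialised.
  have [<- | ij] := eqVneq i j; first by rewrite mulr1n.
  rewrite mulr0n eq_card0 // => w; rewrite !inE; apply/negP.
  by move=> /eqP/conj_rep_inj/enum_val_inj/eqP; rewrite (negPf ij).
apply/matrixP => i j; rewrite !mxE form_higman // raddf_sum.
by apply: eq_bigr => w _; rewrite /= -tF_iota !rmorphM.
Qed.
End Specialisation.

(** * Specialisation of Laurent polynomials *)

Section Laurent.
Variables (I : finType) (K : fieldType) (c : I -> K) (N : nat).
Variables (phi : {rmorphism laurent I -> ratfun K I}).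
Variables (theta : {rmorphism laurent I -> K}).
Hypothesis phi_var : forall i,
  phi (laurent_var i) = ratfun_cst I (c i) * ratfun_var K i ^+ N.
Hypothesis theta_var : forall i, theta (laurent_var i) = c i.

(** [phi r] has no denominator and takes the value [theta r] where all the
    variables are [1]. *)
Let at_one r := exists p : mpoly.mpoly #|I| K,
  phi r = tofrac p /\ theta r = mpoly.meval (fun=> 1) p.

Lemma at_oneD r s : at_one r -> at_one s -> at_one (r + s).
Proof.
move=> [p [p1 p2]] [p' [p'1 p'2]]; exists (p + p').
by rewrite !rmorphD p1 p2 p'1 p'2.
Qed.

Lemma at_oneM r s : at_one r -> at_one s -> at_one (r * s).
Proof.
move=> [p [p1 p2]] [p' [p'1 p'2]]; exists (p * p').
by rewrite !rmorphM p1 p2 p'1 p'2.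
Qed.

Lemma at_one_int n : at_one n%:~R.
Proof. by exists n%:~R; rewrite !rmorph_int. Qed.

Lemma at_one_var i : at_one (laurent_var i).
Proof.
exists (mpoly.mpolyC #|I| (c i) * mpoly.mpolyX K (mpoly.mnm1 (enum_rank i)) ^+ N).
rewrite rmorphM rmorphXn phi_var; split=> //.
by rewrite theta_var rmorphM rmorphXn /= mpoly.mevalC mpoly.mevalXU expr1n mulr1.
Qed.

Lemma at_one_poly (p : mpoly.mpoly #|I| int) (r : laurent I) :
  val r = tofrac p -> at_one r.
Proof.
have valD : {morph (val : laurent I -> ratfun int I) : x y / x + y} by [].
have valM : {morph (val : laurent I -> ratfun int I) : x y / x * y} by [].
have valXm m : exists2 r' : laurent I,
    val r' = tofrac (mpoly.mpolyX int m) & at_one r'.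
  exists (\prod_(j < #|I|) laurent_var (enum_val j) ^+ m j).
    rewrite rmorph_prod mpoly.mpolyXE_id rmorph_prod; apply: eq_bigr => j _.
    by rewrite [LHS]rmorphXn [RHS]rmorphXn /= /ratfun_var enum_valK.
  elim/big_ind: _ => [||j _]; first exact: (at_one_int 1).
    exact: at_oneM.
  elim: (m j) => [|e IHe]; first exact: (at_one_int 1).
  by rewrite exprS; apply: at_oneM => //; apply: at_one_var.
have [r' r'p ext'] : exists2 r' : laurent I, val r' = tofrac p & at_one r'.
  elim/mpoly.mpolyind: p {r} => [|a m p _ _ [r rp ext_r]].
    by exists 0; [rewrite rmorph0 | exact: (at_one_int 0)].
  have [s sm ext_s] := valXm m; exists (a%:~R * s + r).
    rewrite valD valM rmorph_int sm rp -mpoly.mul_mpolyC rmorphD rmorphM.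
    by rewrite -[a in RHS]intz !rmorph_int.
  by apply: at_oneD ext_r; apply: at_oneM ext_s; exact: at_one_int.
by rewrite -r'p => /val_inj ->.
Qed.

(** Multiplying [r] by a monomial, which is invertible, makes it a polynomial, and
    [theta] is then [phi] followed by evaluation. *)
Lemma laurent_specialisation r : phi r = 0 -> theta r = 0.
Proof.
have /asboolP[p [m rE]] := laurent_valP r.
have X0 : tofrac (mpoly.mpolyX int m) != 0 :> ratfun int I.
  rewrite tofrac_eq0; apply/eqP => /(congr1 (mpoly.mcoeff m)) /eqP.
  by rewrite mpoly.mcoeffX eqxx mpoly.mcoeff0 oner_eq0.
have lp (p' : mpoly.mpoly #|I| int) m' :
    tofrac p' / tofrac (mpoly.mpolyX int m') \in @is_laurent I.
  by apply/asboolP; exists p', m'.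
have lpX : tofrac (mpoly.mpolyX int m) \in @is_laurent I.
  have := lp (mpoly.mpolyX int m) mpoly.mnm0.
  by rewrite mpoly.mpolyX0 rmorph1 divr1.
pose x := Laurent lpX.
pose x' := Laurent (lp 1 m).
have xx' : x * x' = 1 by apply: val_inj; rewrite /= tofrac1 mul1r mulfV.
move=> phi0.
have [q [q1 q2]] : at_one (r * x).
  by apply: (at_one_poly (p := p)); rewrite /= rE mulfVK.
have q0 : q = 0 by apply/eqP; rewrite -tofrac_eq0 -q1 rmorphM phi0 mul0r.
have : theta (r * x) = 0 by rewrite q2 q0 rmorph0.
move/(congr1 ( *%R^~ (theta x'))).
by rewrite -rmorphM -mulrA xx' mulr1 mul0r.
Qed.
End Laurent.

(** * The centre of the Hecke algebra *)

Theorem theorem1p2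
    (R : realType) (gT : finGroupType) (n : nat)
    (W : mx_representation R[i] [set: gT]%SET n)
    (W_refl : complex_reflection_group W)
    (* the braid group B, with its natural surjection to W *)
    (x0 : hyp_complement W)
    (B : groupType) (cl : (R -> orbit_space W) -> B)
    (B_braid : is_braid_group x0 cl)
    (pr : B -> gT) (pr_nat : natural_surjection x0 cl pr)
    (* the generic Hecke algebra H *)
    (H : algType (hecke_ring W))
    (q : {lrmorphism group_algebra (hecke_ring W) B -> H})
    (H_hecke : is_hecke_algebra x0 cl q)
    (* the splitting field F and HF = H (x) F *)
    (N : nat) (N_gt0 : (0 < N)%N)
    (phi : {rmorphism hecke_ring W -> hecke_field W})
    (phi_emb : is_hecke_embedding N phi)
    (HF : algType (hecke_field W)) (iota : {rmorphism H -> HF})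
    (HF_ext : is_extension_of_scalars phi iota)
    (HF_split : split_semisimple_alg HF)
    (* the symmetrising trace *)
    (tau : {scalar H}) (tau_sym : symmetrising_trace tau)
    (* the basis b_w, specialising to W, and its dual basis *)
    (b : gT -> H) (b_basis : is_basis b)
    (theta : {rmorphism hecke_ring W -> R[i]})
    (sp : {rmorphism H -> group_algebra R[i] gT})
    (sp_spec : is_specialisation pr q theta sp)
    (b_spec : forall w, sp (b w) = ga_elt R[i] w)
    (bd : gT -> H) (bd_dual : dual_basis tau b bd)
    (* the class representatives *)
    (v : conj_class gT -> gT) (v_rep : forall C, v C \in val C) :
  (exists chi : conj_class gT -> HF -> hecke_field W,
     enumerates_Irr chi /\
     \matrix_(i < #|{: conj_class gT}|, j < #|{: conj_class gT}|)
       chi (enum_val i) (iota (b (v (enum_val j)))) \in unitmx) /\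
  exists zeta : gT -> conj_class gT -> hecke_field W,
    let decomposes (z : gT -> conj_class gT -> hecke_field W) :=
      forall chi, irreducible_character chi ->
      forall w, chi (iota (b w)) = \sum_C z w C * chi (iota (b (v C))) in
    [/\ decomposes zeta,
        forall zeta', decomposes zeta' -> forall w C, zeta' w C = zeta w C &
        is_basis_of (@is_central HF)
          (fun C => \sum_w zeta w C *: iota (bd w))].
Proof.
have [theta_var spZ sp_elt] := sp_spec.
have bE := basis_dual_expansion b_basis bd_dual.
have [tF [tF_iota tFC tFE]] := extend_trace_form HF_ext tau_sym.1 bE.
have phi_theta := laurent_specialisation phi_emb theta_var.
apply: (@symmetric_algebra_centre _ HF gT (conj_class gT)
  (iota \o b) (iota \o bd) tF (fun C => iota (b (v C)))
  (fun C => iota (b ((v C)^-1)%g)) tFC tFE) => //.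
- by move=> w w'; rewrite /= -rmorphM tF_iota bd_dual rmorph_nat.
- exact: (trace_eq0_on_classes phi_theta spZ bE b_spec v_rep HF_ext.1 tFE).
- exact: (class_pairing_unit phi_theta spZ bE b_spec v_rep tF_iota tFC).
Qed.
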